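(* Fix an integer $n\ge0$. The free unital hyperarchimedean vector lattice on $n$ generators, $\mathrm{LC}_n$, is, up to isomorphism, the unique object $(V,u)$ in $\mathsf{uHA}$ such that $V$ has dimension $n$ as a real vector space.
   Context: A vector lattice is a lattice-ordered real vector space. A weak unit of a vector lattice $V$ is an element $u\ge0$ of $V$ such that $u\wedge v=0$ implies $v=0$, for all $v\in V$. $V$ is Archimedean if, for all $v,w\in V$, $0<v\le w$ implies $nv\not\le w$ for some positive integer $n$; it is hyperarchimedean if all its homomorphic images are Archimedean. $\mathsf{uHA}$ is the category whose objects are pairs $(V,u)$ with $V$ a hyperarchimedean vector lattice and $u$ a distinguished weak unit of $V$, and whose morphisms are the linear lattice homomorphisms preserving the distinguished units. For a compact space $X$, $\mathrm{LC}(X)$ is the vector lattice of all locally constant functions $X\to\mathbb{R}$ (each point of $X$ has an open neighbourhood on which the function is constant), with pointwise operations and with distinguished unit the constant function $1_X$. For a cardinal $\kappa$, $\mathrm{LC}_\kappa$ denotes $\mathrm{LC}(\{0,1\}^{|S|})$, where $S$ is any set of cardinality $\kappa$ and $\{0,1\}^{|S|}$ is the product of $|S|$ copies of the discrete space $\{0,1\}$, endowed with the product topology; $\mathrm{LC}_\kappa$ is called the free unital hyperarchimedean vector lattice on $\kappa$ generators.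
   Formalization: The dimension n is corrected to 2^n: {0,1}^n is a discrete space with 2^n points, so LC_n has dimension 2^n, which never equals n (for n = 0, LC_0 = R has dimension 1); the theorem says LC_n is the unique object of uHA of dimension 2^n. *)

(* Defs.v *)
From HB Require Import structures.
From mathcomp Require Import all_boot all_order all_algebra.
From mathcomp Require Import boolp classical_sets functions cardinality reals.
From mathcomp Require Import topology.
Set Implicit Arguments.
Unset Strict Implicit.
Unset Printing Implicit Defensive.
Import Order.TTheory GRing.Theory Num.Theory.

Local Open Scope classical_set_scope.
Local Open Scope ring_scope.

(* Lattice operations are given here by their universal properties: the
   lattice structures of the order library cannot be joined with the module
   structures through Hierarchy-Builder, because ordered number domains already
   inherit from both sides without an intermediate structure. *)
HB.mixin Record isVectorLattice (R : realType) V
    of GRing.Lmodule R V & Num.POrderedZmodule V := {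
  vmeet : V -> V -> V ;
  vjoin : V -> V -> V ;
  le_vmeet : forall x y z : V, (z <= vmeet x y) = (z <= x) && (z <= y) ;
  vjoin_le : forall x y z : V, (vjoin x y <= z) = (x <= z) && (y <= z) ;
  vlat_leD2r : forall z x y : V, x <= y -> x + z <= y + z ;
  vlat_scale_ge0 : forall (a : R) (x : V), 0 <= a -> 0 <= x -> 0 <= a *: x
}.

#[short(type="vectorLatticeType")]
HB.structure Definition VectorLattice (R : realType) :=
  { V of GRing.Lmodule R V & Num.POrderedZmodule V & isVectorLattice R V }.

Section VectorLatticeNotions.
Variable R : realType.

Definition weak_unit (V : vectorLatticeType R) (u : V) : Prop :=
  0 <= u /\ forall v : V, vmeet u v = 0 -> v = 0.

Definition archimedean (V : vectorLatticeType R) : Prop :=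
  forall v w : V, 0 < v -> v <= w ->
    exists n : nat, (0 < n)%N /\ ~ (v *+ n <= w).

Definition linear_lattice_hom (V W : vectorLatticeType R) (f : V -> W) : Prop :=
  [/\ linear f,
      {morph f : x y / vmeet x y}
    & {morph f : x y / vjoin x y}].

Definition hyperarchimedean (V : vectorLatticeType R) : Prop :=
  forall (W : vectorLatticeType R) (f : V -> W),
    linear_lattice_hom f -> (forall w, exists v, f v = w) -> archimedean W.

Definition uHA_object (V : vectorLatticeType R) (u : V) : Prop :=
  hyperarchimedean V /\ weak_unit u.

Definition uHA_morphism (V : vectorLatticeType R) (u : V)
    (W : vectorLatticeType R) (w : W) (f : V -> W) : Prop :=
  linear_lattice_hom f /\ f u = w.

Definition uHA_isomorphic (V : vectorLatticeType R) (u : V)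
    (W : vectorLatticeType R) (w : W) : Prop :=
  exists (f : V -> W) (g : W -> V),
    [/\ uHA_morphism u w f, uHA_morphism w u g, cancel f g & cancel g f].

Definition has_dimension (V : lmodType R) (n : nat) : Prop :=
  exists b : 'I_n -> V,
    (forall c : 'I_n -> R, \sum_i c i *: b i = 0 -> forall i, c i = 0) /\
    (forall v : V, exists c : 'I_n -> R, v = \sum_i c i *: b i).

End VectorLatticeNotions.

Section LocallyConstant.
Variables (R : realType) (X : topologicalType).

Definition locally_constant (f : X -> R) : Prop :=
  forall x, exists U : set X,
    open_nbhs x U /\ forall y z, U y -> U z -> f y = f z.

Definition LC_pred : {pred X -> R^o} := fun f => `[< locally_constant f >].

Lemma locally_constant_cst (a : R) : locally_constant (fun=> a).
Proof. by move=> x; exists setT; split=> //; split=> //; exact: openT. Qed.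

Lemma locally_constant_comp2 (op : R -> R -> R) (f g : X -> R) :
  locally_constant f -> locally_constant g ->
  locally_constant (fun x => op (f x) (g x)).
Proof.
move=> fc gc x; have [U [Ux Uf]] := fc x; have [W [Wx Wg]] := gc x.
exists (U `&` W); split; first exact: open_nbhsI.
by move=> y z [Uy Wy] [Uz Wz]; rewrite (Uf y z)// (Wg y z).
Qed.

Fact LC_submod_closed : submod_closed LC_pred.
Proof.
split; first by apply/asboolP/locally_constant_cst.
move=> a f g /asboolP fc /asboolP gc; apply/asboolP.
exact: (locally_constant_comp2 (fun s t => a * s + t)).
Qed.
HB.instance Definition _ :=
  GRing.isSubmodClosed.Build R (X -> R^o) LC_pred LC_submod_closed.

Record LC : Type := MkLC { LC_fun :> X -> R^o ; _ : LC_fun \in LC_pred }.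

HB.instance Definition _ := [isSub for LC_fun].
HB.instance Definition _ := [Choice of LC by <:].
HB.instance Definition _ := [SubChoice_isSubLmodule of LC by <:].
HB.instance Definition _ :=
  [SubChoice_isSubPOrder of LC by <: with ring_display].

Lemma LC_leP (f g : LC) : reflect (forall x, f x <= g x) (f <= g).
Proof. by rewrite -Order.le_val; exact: lefP. Qed.

Fact LC_meet_subproof (f g : LC) :
  (fun x => Num.min (f x) (g x)) \in LC_pred.
Proof.
have /asboolP fc := valP f; have /asboolP gc := valP g; apply/asboolP.
exact: (locally_constant_comp2 Num.min).
Qed.
Definition LC_meet (f g : LC) : LC := MkLC (LC_meet_subproof f g).

Fact LC_join_subproof (f g : LC) :
  (fun x => Num.max (f x) (g x)) \in LC_pred.
Proof.
have /asboolP fc := valP f; have /asboolP gc := valP g; apply/asboolP.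
exact: (locally_constant_comp2 Num.max).
Qed.
Definition LC_join (f g : LC) : LC := MkLC (LC_join_subproof f g).

Fact LC_le_meet (f g h : LC) : (h <= LC_meet f g) = (h <= f) && (h <= g).
Proof.
apply/idP/andP => [/LC_leP hfg|[/LC_leP hf /LC_leP hg]]; last first.
  by apply/LC_leP => x; rewrite le_min hf hg.
by split; apply/LC_leP => x; move: (hfg x); rewrite le_min => /andP[].
Qed.

Fact LC_join_le (f g h : LC) : (LC_join f g <= h) = (f <= h) && (g <= h).
Proof.
apply/idP/andP => [/LC_leP fgh|[/LC_leP fh /LC_leP gh]]; last first.
  by apply/LC_leP => x; rewrite ge_max fh gh.
by split; apply/LC_leP => x; move: (fgh x); rewrite ge_max => /andP[].
Qed.

Fact LC_leD2r (h f g : LC) : f <= g -> f + h <= g + h.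
Proof. by move=> /LC_leP fg; apply/LC_leP => x; apply: lerD. Qed.

Fact LC_scale_ge0 (a : R) (f : LC) : 0 <= a -> 0 <= f -> 0 <= a *: f.
Proof.
by move=> a0 /LC_leP f0; apply/LC_leP => x; apply: mulr_ge0 => //; exact: f0.
Qed.
HB.instance Definition _ := isVectorLattice.Build R LC
  LC_le_meet LC_join_le LC_leD2r LC_scale_ge0.

Definition LC_one : LC := MkLC (asboolT (locally_constant_cst 1)).

End LocallyConstant.

Definition cube (S : Type) : topologicalType :=
  prod_topology (fun _ : S => bool : topologicalType).

(* Here a cardinal is presented by a set [S] of that cardinality. *)
Definition LC_free (R : realType) (S : Type) : vectorLatticeType R :=
  LC R (cube S).

Definition LC_free_unit (R : realType) (S : Type) : LC_free R S :=
  LC_one R (cube S).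

(* Main.v *)
Require Import Defs.
From mathcomp Require Import all_boot all_order all_algebra.
From mathcomp Require Import boolp classical_sets functions cardinality reals.
From mathcomp Require Import topology.

(* In an Archimedean vector lattice of dimension [N], pairwise disjoint positive
   vectors are linearly independent, so there is a disjoint family of maximal
   length. By maximality its members are atoms; along an atom [e] every vector
   [x] has a coordinate [a] with [|x - a e| /\ e = 0], and maximality again
   forces [x] to be the sum of its components. Hence the family is a basis in
   which the order is coordinatewise, and rescaling it so that the weak unit is
   the sum of the basis identifies the lattice with the functions on [N] points.
   In the other direction, the cube on finitely many coordinates is finite and
   discrete, so [LC] of it is such a lattice of functions. *)

Set Implicit Arguments.
Unset Strict Implicit.
Unset Printing Implicit Defensive.
Import Order.TTheory GRing.Theory Num.Theory.

Local Open Scope classical_set_scope.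
Local Open Scope card_scope.
Local Open Scope ring_scope.

(** * Order arithmetic and lattice operations in a vector lattice *)

Section VectorLatticeTheory.
Variables (R : realType) (V : vectorLatticeType R).
Implicit Types (x y z w e d u : V) (a b c : R).

Lemma vleD2r z x y : (x + z <= y + z) = (x <= y).
Proof.
apply/idP/idP => [|xy]; last exact: vlat_leD2r.
by move/(vlat_leD2r (- z)); rewrite !addrK.
Qed.

Lemma vleD x y z w : x <= y -> z <= w -> x + z <= y + w.
Proof.
move=> xy zw; apply: (@le_trans _ _ (y + z)); first by rewrite vleD2r.
by rewrite ![y + _]addrC vleD2r.
Qed.

Lemma vsubr_ge0 x y : (0 <= y - x) = (x <= y).
Proof. by rewrite -(vleD2r x 0) subrK add0r. Qed.

Lemma vleN x y : (- x <= - y) = (y <= x).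
Proof. by rewrite -(vsubr_ge0 (- x)) opprK addrC vsubr_ge0. Qed.

Lemma vleBlDr x y z : (x - y <= z) = (x <= z + y).
Proof. by rewrite -(vleD2r y (x - y)) subrK. Qed.

Lemma vler_wpDr x y : 0 <= y -> x <= x + y.
Proof. by move=> y0; rewrite -vsubr_ge0 addrC addKr. Qed.

Lemma vsumr_ge0 (I : finType) (P : pred I) (F : I -> V) :
  (forall i, P i -> 0 <= F i) -> 0 <= \sum_(i | P i) F i.
Proof.
by move=> F0; apply: (big_ind (fun x => 0 <= x)) => // x y x0 y0;
  rewrite -[0]addr0 vleD.
Qed.

Lemma vsumr_le (I : finType) (P : pred I) (F G : I -> V) :
  (forall i, P i -> F i <= G i) -> \sum_(i | P i) F i <= \sum_(i | P i) G i.
Proof.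
move=> FG; rewrite -vsubr_ge0 -sumrB; apply: vsumr_ge0 => i Pi.
by rewrite vsubr_ge0 FG.
Qed.

Lemma vler_wpZ2l a x y : 0 <= a -> x <= y -> a *: x <= a *: y.
Proof.
by move=> a0 xy; rewrite -vsubr_ge0 -scalerBr vlat_scale_ge0// vsubr_ge0.
Qed.

Lemma vler_pZ2l a x y : 0 < a -> (a *: x <= a *: y) = (x <= y).
Proof.
move=> a0; apply/idP/idP => [|xy]; last exact: vler_wpZ2l (ltW a0) xy.
move/(@vler_wpZ2l a^-1); rewrite invr_ge0 ltW// => /(_ isT).
by rewrite !scalerA mulVf ?gt_eqF// !scale1r.
Qed.

Lemma vler_wpZ2r a b x : 0 <= x -> a <= b -> a *: x <= b *: x.
Proof.
by move=> x0 ab; rewrite -vsubr_ge0 -scalerBl vlat_scale_ge0// subr_ge0.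
Qed.

Lemma vmeet_lel x y : vmeet x y <= x.
Proof. by have := lexx (vmeet x y); rewrite le_vmeet => /andP[]. Qed.

Lemma vmeet_ler x y : vmeet x y <= y.
Proof. by have := lexx (vmeet x y); rewrite le_vmeet => /andP[]. Qed.

Lemma vjoin_gel x y : x <= vjoin x y.
Proof. by have := lexx (vjoin x y); rewrite vjoin_le => /andP[]. Qed.

Lemma vjoin_ger x y : y <= vjoin x y.
Proof. by have := lexx (vjoin x y); rewrite vjoin_le => /andP[]. Qed.

Lemma vmeet_eqP x y z :
  (forall w, (w <= z) = (w <= x) && (w <= y)) -> vmeet x y = z.
Proof.
by move=> h; apply/le_anti; rewrite h vmeet_lel vmeet_ler le_vmeet -h lexx.
Qed.

Lemma vjoin_eqP x y z :
  (forall w, (z <= w) = (x <= w) && (y <= w)) -> vjoin x y = z.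
Proof.
by move=> h; apply/le_anti; rewrite h vjoin_gel vjoin_ger vjoin_le -h lexx.
Qed.

(** * Disjointness *)

(** For nonnegative vectors this is [vmeet x y = 0]; the inequality passes to smaller vectors
    without any sign condition. *)
Definition disj x y := vmeet x y <= 0.

Lemma disjP x y :
  reflect (forall z, z <= x -> z <= y -> z <= 0) (disj x y).
Proof.
apply: (iffP idP) => [xy z zx zy|]; last first.
  by apply; [exact: vmeet_lel|exact: vmeet_ler].
by apply: le_trans xy; rewrite le_vmeet zx.
Qed.

Lemma disjC x y : disj x y = disj y x.
Proof. by apply/disjP/disjP => h z *; exact: h. Qed.

Lemma disjS x x' y y' : x' <= x -> y' <= y -> disj x y -> disj x' y'.
Proof.
move=> xx yy /disjP h; apply/disjP => z zx zy.
by apply: h; [exact: le_trans zx xx|exact: le_trans zy yy].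
Qed.

Lemma disj0l x : 0 <= x -> disj 0 x.
Proof. by move=> ?; apply/disjP. Qed.

(** If [t <= x + y] and [t <= z], then [t - y] is below [x] and [z], so [t <= y], and disjointness
    of [y] and [z] gives [t <= 0]. *)
Lemma disjDl x y z : 0 <= x -> 0 <= y -> 0 <= z ->
  disj x z -> disj y z -> disj (x + y) z.
Proof.
move=> x0 y0 z0 /disjP xz /disjP yz; apply/disjP => t txy tz.
apply: yz => //; rewrite -[y]add0r -vleBlDr; apply: xz.
  by rewrite vleBlDr.
by apply: le_trans tz; rewrite vleBlDr vler_wpDr.
Qed.

Lemma disjZl a x y : 0 <= x -> 0 <= y -> disj x y -> disj (a *: x) y.
Proof.
move=> x0 y0 /disjP xy; apply/disjP => z za zy.
(* With [m := Num.max a 1], both [a *: x <= m *: x] and [y <= m *: y], so [m^-1 *: z] is a lower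
   bound of [x] and [y]. *)
have m0 : 0 < Num.max a 1 by rewrite lt_max ltr01 orbT.
have h t : z <= Num.max a 1 *: t -> (Num.max a 1)^-1 *: z <= t.
  by move=> zt; rewrite -(vler_pZ2l _ _ m0) scalerA divff ?gt_eqF// scale1r.
rewrite -(@vler_pZ2l (Num.max a 1)^-1) ?invr_gt0// scaler0; apply: xy; apply: h.
  by apply: le_trans za _; apply: vler_wpZ2r => //; rewrite le_max lexx.
apply: le_trans zy _; rewrite -{1}[y]scale1r; apply: vler_wpZ2r => //.
by rewrite le_max lexx orbT.
Qed.

Lemma disj_suml (I : finType) (P : pred I) (F : I -> V) z : 0 <= z ->
  (forall i, P i -> 0 <= F i /\ disj (F i) z) -> disj (\sum_(i | P i) F i) z.
Proof.
move=> z0 FP; suff [] : 0 <= \sum_(i | P i) F i /\ disj (\sum_(i | P i) F i) z.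
  by [].
apply: (big_ind (fun x => 0 <= x /\ disj x z)) => //.
  by split=> //; exact: disj0l.
move=> x y [x0 xz] [y0 yz]; split; last exact: disjDl.
by rewrite -[0]addr0 vleD.
Qed.

(** * Positive part and absolute value *)

Definition vpos x := vjoin x 0.

Lemma vpos_ge x : x <= vpos x. Proof. exact: vjoin_gel. Qed.

Lemma vpos_ge0 x : 0 <= vpos x. Proof. exact: vjoin_ger. Qed.

Lemma vpos_le x y : (vpos x <= y) = (x <= y) && (0 <= y).
Proof. exact: vjoin_le. Qed.

Lemma vpos_eq0 x : (vpos x == 0) = (x <= 0).
Proof. by rewrite eq_le vpos_ge0 vpos_le lexx !andbT. Qed.

Lemma vposN x : vpos (- x) = vpos x - x.
Proof.
apply: vjoin_eqP => y.
by rewrite vleBlDr vpos_le -{1}[x]add0r vleD2r andbC -vleBlDr sub0r.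
Qed.

Lemma disj_vposN x : disj (vpos x) (vpos (- x)).
Proof.
apply/disjP => z zx; rewrite vposN -vsubr_ge0 addrAC vsubr_ge0 => xz.
have {}xz : vpos x <= vpos x - z.
  by rewrite vpos_le xz vsubr_ge0.
by rewrite -(vleD2r (vpos x - z)) add0r subrKC.
Qed.

Lemma vposD x y : vpos (x + y) <= vpos x + vpos y.
Proof.
by rewrite vpos_le vleD ?vpos_ge//= -[0]addr0 vleD// vpos_ge0.
Qed.

(** The absolute value, written as a sum so that its disjointness from a vector reduces by [disjDl]
    to the two parts. *)
Definition vnorm x := vpos x + vpos (- x).

Lemma vnorm_ge0 x : 0 <= vnorm x.
Proof. by rewrite -[0]addr0 vleD// vpos_ge0. Qed.

Lemma vnormN x : vnorm (- x) = vnorm x.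
Proof. by rewrite /vnorm opprK addrC. Qed.

Lemma vnorm_ge x : x <= vnorm x.
Proof. by apply: le_trans (vpos_ge x) _; rewrite vler_wpDr ?vpos_ge0. Qed.

Lemma vnorm_eq0 x : vnorm x = 0 -> x = 0.
Proof.
move=> x0; apply/le_anti; have := vnorm_ge x; have := vnorm_ge (- x).
by rewrite vnormN x0 -vleN opprK oppr0 => -> ->.
Qed.

Lemma vnormD x y : vnorm (x + y) <= vnorm x + vnorm y.
Proof.
rewrite /vnorm opprD [leRHS]addrACA; apply: vleD; exact: vposD.
Qed.

Lemma vnormB x y : vnorm (x - y) <= vnorm x + vnorm y.
Proof. by rewrite -(vnormN y) vnormD. Qed.

Lemma vnorm0 : vnorm 0 = 0.
Proof.
have v0 : vpos 0 = 0 by apply/eqP; rewrite vpos_eq0.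
by rewrite /vnorm oppr0 v0 addr0.
Qed.

Lemma vnorm_sum (I : finType) (P : pred I) (F : I -> V) :
  vnorm (\sum_(i | P i) F i) <= \sum_(i | P i) vnorm (F i).
Proof.
apply: (big_ind2 (fun x y => vnorm x <= y)) => [|x1 y1 x2 y2 xy1 xy2|//].
  by rewrite vnorm0.
exact: le_trans (vnormD _ _) (vleD xy1 xy2).
Qed.

Lemma vnormZ_ge0 a x : 0 <= x -> vnorm (a *: x) = `|a| *: x.
Proof.
move=> x0; have h b : 0 <= b -> vnorm (b *: x) = b *: x.
  move=> b0; have bx : 0 <= b *: x by rewrite vlat_scale_ge0.
  rewrite /vnorm vposN [_ + (_ - _)]addrA.
  have -> : vpos (b *: x) = b *: x; last by rewrite addrK.
  by apply/le_anti; rewrite vpos_ge vpos_le lexx bx.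
have [a0|a0] := leP 0 a; first by rewrite ger0_norm// h.
by rewrite ltr0_norm// -(h (- a)) ?oppr_ge0 ?ltW// scaleNr vnormN.
Qed.

(** * Archimedean limits and coordinates along an atom *)

Hypothesis archV : archimedean V.

Lemma archimedean_eq0 v w : 0 <= v -> (forall n, v *+ n.+1 <= w) -> v = 0.
Proof.
move=> v0 nv; apply/eqP/negP => /negP vn0.
have [||n [n0]] := @archV v w; first by rewrite lt_def vn0.
  by rewrite -[v]mulr1n.
by apply; case: n n0.
Qed.

Lemma archimedean_eps v w : 0 <= v -> (forall a, 0 < a -> v <= a *: w) -> v = 0.
Proof.
move=> v0 vw; apply: (@archimedean_eq0 v w) => // n.
have n0 : 0 < (n.+1%:R : R) by rewrite ltr0n.
have := vw n.+1%:R^-1; rewrite invr_gt0 => /(_ n0).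
rewrite -(vler_pZ2l _ _ n0) scalerA divff ?gt_eqF// scale1r.
by rewrite scaler_nat.
Qed.

(** The vector [vmeet (vpos x) e - a *: e] is below both [vpos (x - a *: e)] and [e], hence
    [vmeet (vpos x) e <= a *: e] for all [a > 0]. *)
Lemma disj_vpos_closed x e : 0 <= e ->
  (forall a, 0 < a -> disj (vpos (x - a *: e)) e) -> disj (vpos x) e.
Proof.
move=> e0 h; rewrite /disj (@archimedean_eps (vmeet (vpos x) e) e)//.
  by rewrite le_vmeet vpos_ge0.
move=> a a0; have ae0 : 0 <= a *: e by rewrite vlat_scale_ge0// ltW.
rewrite -[_ *: _]add0r -vleBlDr; move/disjP: (h a a0); apply.
  rewrite vleBlDr; apply: (le_trans (vmeet_lel _ _)).
  rewrite vpos_le -vleBlDr vpos_ge/=.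
  by rewrite -[0]addr0 vleD// vpos_ge0.
rewrite vleBlDr; apply: (le_trans (vmeet_ler _ _)).
by rewrite vler_wpDr.
Qed.

(* For [e > 0] this says that no two nonzero elements below [e] are disjoint:
   a disjoint pair [x, y] would be separated by [w := x - y]. *)
Definition vatom e := 0 < e /\ forall w, disj (vpos w) e \/ disj (vpos (- w)) e.

(* The coordinate of [x] along the atom [e] is the supremum of all [t] such
   that [t *: e] is below [x] on the band of [e]. *)
Lemma atom_coord e x : vatom e -> exists a, disj (vnorm (x - a *: e)) e.
Proof.
move=> [e0 eat]; have e0' := ltW e0.
pose below := [set t | disj (vpos (t *: e - x)) e].
have belowS s t : s <= t -> below t -> below s.
  move=> st; apply: disjS => //.
  rewrite vpos_le vpos_ge0 andbT; apply: le_trans (vpos_ge _).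
  by rewrite vleD2r vler_wpZ2r.
(* Otherwise every multiple [e *+ n.+1] would be below [vnorm y]. Taking [y := x] bounds [below]
   from above; [y := - x] and the atom alternative make it nonempty. *)
have bound y : exists2 s, 0 < s & ~~ disj (vpos (s *: e - y)) e.
  apply: contrapT => /forall2NP h.
  suff: e = 0 by move=> E; rewrite E ltxx in e0.
  apply: (@archimedean_eq0 _ (vnorm y)) => // n.
  have {h}[/negP|/negP] := h n.+1%:R; first by rewrite ltr0n.
  rewrite negbK disjC -scaler_nat.
  move=> /(@disjZl n.+1%:R _ _ e0' (vpos_ge0 _)) /disjP h.
  rewrite -[vnorm _]add0r -vleBlDr; apply: h.
    by rewrite vleBlDr vler_wpDr ?vnorm_ge0.
  apply: le_trans (vpos_ge _).
  by rewrite [leLHS]addrC [leRHS]addrC vleD2r vleN vnorm_ge.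
have has_sup_below : has_sup below.
  split.
    have [s _ sx] := bound (- x); exists (- s).
    have [//|] := eat (- s *: e - x).
    by rewrite opprB scaleNr opprK -[x in x + _]opprK addrC (negbTE sx).
  have [s _ sx] := bound x; exists s => t bt; rewrite leNgt; apply/negP => st.
  by move: sx; rewrite (belowS s t (ltW st) bt).
(* Just above the supremum the atom alternative gives one half of the absolute value; just below it
   an element of [below] gives the other. [disj_vpos_closed] passes to the limit. *)
exists (sup below); apply: disjDl; rewrite ?vpos_ge0//.
  apply: disj_vpos_closed => // a a0.
  have [nb|] := eat ((sup below + a) *: e - x); last first.
    by rewrite opprB scalerDl opprD addrA.
  have := sup_upper_bound has_sup_below nb.
  by rewrite gerDl leNgt a0.
apply: disj_vpos_closed => // a a0.
rewrite opprB addrAC -scalerBl.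
have [t bt st] := sup_adherent a0 has_sup_below.
exact: belowS (ltW st) bt.
Qed.
End VectorLatticeTheory.

(** * Independent families are no longer than spanning ones *)

Section LinearIndependence.
Variables (F : fieldType) (V : lmodType F).

Definition lin_indep n (e : 'I_n -> V) :=
  forall c : 'I_n -> F, \sum_i c i *: e i = 0 -> forall i, c i = 0.

Definition spanning n (e : 'I_n -> V) :=
  forall v : V, exists c : 'I_n -> F, v = \sum_i c i *: e i.

(** A row vector in the left kernel of the coefficient matrix of [e] over [b] is a linear relation
    among the [e i], so the matrix has rank [m], at most its number [n] of columns. *)
Lemma lin_indep_spanning_leq m n (e : 'I_m -> V) (b : 'I_n -> V) :
  lin_indep e -> spanning b -> (m <= n)%N.
Proof.
move=> e_indep b_span; have /choice[C eC] : forall i, exists c : 'I_n -> F,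
  e i = \sum_j c j *: b j by move=> i; exact: b_span.
pose M := \matrix_(i, j) C i j.
suff /eqP <- : row_free M by exact: rank_leq_col.
rewrite -kermx_eq0; apply/rowV0P => r /sub_kermxP rM.
apply/rowP => i; rewrite mxE; apply: (e_indep (fun i => r 0 i)).
transitivity (\sum_j (r *m M) 0 j *: b j); last first.
  by rewrite rM big1 // => j _; rewrite mxE scale0r.
under eq_bigr do rewrite eC scaler_sumr.
rewrite exchange_big; apply: eq_bigr => j _; rewrite mxE scaler_suml.
by apply: eq_bigr => i' _; rewrite mxE scalerA.
Qed.

End LinearIndependence.

(** * Disjoint families of positive vectors as bases *)

Section DisjointFamilies.
Variables (R : realType) (V : vectorLatticeType R).

Definition disjoint_family n (e : 'I_n -> V) :=
  (forall i, 0 < e i) /\ (forall i j, i != j -> disj (e i) (e j)).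

(** A negative [c i] would put [- c i *: e i] below the sum of the absolute values of the other
    terms, from which it is disjoint. *)
Lemma disjoint_family_coord_ge0 n (e : 'I_n -> V) (c : 'I_n -> R) :
  disjoint_family e -> 0 <= \sum_i c i *: e i -> forall i, 0 <= c i.
Proof.
move=> [e0 ed]; have e0' i : 0 <= e i by exact: ltW.
move=> c0 i; rewrite leNgt; apply/negP => ci.
have ci0 : 0 < - c i by rewrite oppr_gt0.
suff: - c i *: e i <= 0.
  rewrite -(scaler0 _ (- c i)) vler_pZ2l// => ei.
  by have := lt_le_trans (e0 i) ei; rewrite ltxx.
have dj : disj (\sum_(j | j != i) `|c j| *: e j) (e i).
  apply: disj_suml => // j ji; split; first by rewrite vlat_scale_ge0.
  by apply: disjZl; rewrite ?ed.
rewrite disjC in dj.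
have /disjP := @disjZl _ _ (- c i) _ _ (e0' i)
  (vsumr_ge0 (fun j _ => vlat_scale_ge0 _ _ (normr_ge0 (c j)) (e0' j))) dj.
apply=> //; rewrite scaleNr -sub0r vleBlDr.
apply: (le_trans c0); rewrite (bigD1 i)//= addrC vleD2r.
by apply: vsumr_le => j _; apply: vler_wpZ2r => //; exact: ler_norm.
Qed.

Lemma disjoint_family_lin_indep n (e : 'I_n -> V) :
  disjoint_family e -> lin_indep e.
Proof.
move=> ed c c0 i; apply/le_anti; apply/andP; split; last first.
  by apply: (disjoint_family_coord_ge0 ed); rewrite c0.
rewrite -oppr_ge0; apply: (disjoint_family_coord_ge0 (c := fun i => - c i) ed).
by under eq_bigr do rewrite scaleNr; rewrite sumrN c0 oppr0.
Qed.

Lemma disjoint_family_extend n (e : 'I_n -> V) x :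
  disjoint_family e -> 0 < x -> (forall i, disj x (e i)) ->
  exists e' : 'I_n.+1 -> V, disjoint_family e'.
Proof.
move=> [e0 ed] x0 xd.
exists (fun i => if unlift ord_max i is Some j then e j else x); split.
  by move=> i; case: unliftP.
move=> i j; case: unliftP => [i'|] ->; case: unliftP => [j'|] -> //.
- by rewrite (inj_eq lift_inj); exact: ed.
- by rewrite disjC.
- by rewrite eqxx.
Qed.

Lemma vmeet_gt0 (x y : V) : 0 <= x -> 0 <= y -> ~~ disj x y -> 0 < vmeet x y.
Proof.
move=> x0 y0; rewrite /disj => xy; rewrite lt_def le_vmeet x0 y0 !andbT.
by apply: contra xy => /eqP ->.
Qed.

Lemma maximal_disjoint_family_atom n (e : 'I_n -> V) :
  disjoint_family e -> ~ (exists e' : 'I_n.+1 -> V, disjoint_family e') ->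
  forall i, vatom (e i).
Proof.
move=> [e0 ed] max_e i; split=> // w; have e0' j : 0 <= e j by exact: ltW.
apply: contrapT => /not_orP[/negP pw /negP nw]; apply: max_e.
(* If [w] split [e i], replacing [e i] by [p] and appending [q] would give a longer disjoint
   family. *)
pose p := vmeet (vpos w) (e i); pose q := vmeet (vpos (- w)) (e i).
apply: (@disjoint_family_extend n (fun j => if j == i then p else e j) q).
- split=> [j|j k jk]; first by case: eqP => // _; rewrite vmeet_gt0// vpos_ge0.
  case: (eqVneq j i) jk => [->|ji]; case: (eqVneq k i) => [_|ki] jk.
  + by [].
  + by apply: (disjS (vmeet_ler _ _) (lexx _)); rewrite ed // eq_sym.
  + by apply: (disjS (lexx _) (vmeet_ler _ _)); rewrite ed.
  + exact: ed.
- by rewrite vmeet_gt0// vpos_ge0.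
- move=> j; case: eqP => [_|/eqP ji].
    apply: (disjS (vmeet_lel _ _) (vmeet_lel _ _)).
    by rewrite disjC disj_vposN.
  by apply: (disjS (vmeet_ler _ _) (lexx _)); rewrite ed// eq_sym.
Qed.

Hypothesis archV : archimedean V.

Lemma maximal_disjoint_family_spanning n (e : 'I_n -> V) :
  disjoint_family e -> ~ (exists e' : 'I_n.+1 -> V, disjoint_family e') ->
  spanning e.
Proof.
move=> ed max_e x; have e0' j : 0 <= e j by apply: ltW; case: ed => + _; apply.
have /choice[c xc] : forall i, exists c : R, disj (vnorm (x - c *: e i)) (e i).
  by move=> i; apply: (atom_coord archV); exact: maximal_disjoint_family_atom.
exists c; apply/eqP; rewrite -subr_eq0; apply/eqP/vnorm_eq0.
apply: contrapT => /eqP y0; apply: max_e.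
(* A nonzero residue would lengthen the family: its absolute value is at most
   [vnorm (x - c i *: e i)] plus the absolute values of the other components, all disjoint from
   [e i]. *)
apply: (disjoint_family_extend (x := vnorm (x - \sum_i c i *: e i)) ed).
  by rewrite lt_def y0 vnorm_ge0.
move=> i.
have z0 : 0 <= \sum_(j | j != i) `|c j| *: e j.
  by apply: vsumr_ge0 => j _; rewrite vlat_scale_ge0.
have dz : disj (\sum_(j | j != i) `|c j| *: e j) (e i).
  apply: disj_suml => // j ji; split; first by rewrite vlat_scale_ge0.
  by apply: disjZl => //; case: ed => _; apply.
apply: disjS (lexx (e i)) (disjDl (vnorm_ge0 _) z0 (e0' i) (xc i) dz).
rewrite (bigD1 i)//= opprD addrA; apply: le_trans (vnormB _ _) _.
rewrite ![vnorm (_ - _) + _]addrC vleD2r.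
apply: le_trans (vnorm_sum _ _) _; apply: vsumr_le => j _.
by rewrite vnormZ_ge0.
Qed.

Lemma disjoint_family_dimension n : has_dimension V n ->
  exists e : 'I_n -> V, disjoint_family e /\ spanning e.
Proof.
move=> [b [b_indep b_span]].
(* The empty family exists and independence bounds lengths by [n], so there is a longest family; it
   spans by maximality, hence has length [n]. *)
pose P k := `[< exists e : 'I_k -> V, disjoint_family e >].
have P0 : exists k, P k.
  by exists 0; apply/asboolP; exists (fun _ => 0); split=> -[].
have Pn k : P k -> (k <= n)%N.
  move=> /asboolP[e /disjoint_family_lin_indep e_indep].
  exact: lin_indep_spanning_leq e_indep b_span.
case: (ex_maxnP P0 Pn) => k /asboolP[e ed] max_k.
have e_span : spanning e.
  apply: maximal_disjoint_family_spanning ed _ => e'.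
  by have /max_k := asboolT e'; rewrite ltnn.
have kn : k = n.
  apply/eqP; rewrite eqn_leq Pn/=; last by apply/asboolP; exists e.
  exact: lin_indep_spanning_leq b_indep e_span.
by subst k; exists e.
Qed.

Lemma unit_coordinates n (u : V) : weak_unit u -> has_dimension V n ->
  exists e : 'I_n -> V, [/\ disjoint_family e, spanning e & u = \sum_i e i].
Proof.
move=> [u0 uw] /disjoint_family_dimension[e [ed e_span]].
have [c uc] := e_span u; have [e0 edisj] := ed.
have e0' j : 0 <= e j by exact: ltW.
have c_ge0 : forall i, 0 <= c i.
  by apply: (disjoint_family_coord_ge0 ed); rewrite -uc.
have c_gt0 i : 0 < c i.
  (* A zero coefficient would make the weak unit [u] disjoint from [e i]. So all coefficients are
     positive and can be absorbed into the basis. *)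
  rewrite lt_def c_ge0 andbT; apply/eqP => ci0.
  suff ei0 : e i = 0 by have := e0 i; rewrite ei0 ltxx.
  apply: uw; apply/le_anti; rewrite le_vmeet u0 e0' !andbT.
  rewrite uc (bigD1 i)//= ci0 scale0r add0r; apply: disj_suml => // j ji.
  by split; [rewrite vlat_scale_ge0|apply: disjZl; rewrite ?edisj].
exists (fun i => c i *: e i); split=> //.
- split=> [i|i j ij].
    rewrite lt_def vlat_scale_ge0// andbT scaler_eq0 !gt_eqF//.
  by rewrite disjZl ?vlat_scale_ge0// disjC disjZl// edisj// eq_sym.
- move=> v; have [d vd] := e_span v; exists (fun i => d i / c i).
  by rewrite vd; apply: eq_bigr => i _; rewrite scalerA divfK ?gt_eqF.
Qed.

End DisjointFamilies.

(** * Linear order isomorphisms *)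

Section OrderIsomorphisms.
Variable R : realType.

(** Meets and joins are determined by the order, so a surjective order embedding preserves them. *)
Lemma linear_order_iso_lattice_hom (V W : vectorLatticeType R) (g : W -> V) :
  linear g -> (forall x y, (g x <= g y) = (x <= y)) ->
  (forall v, exists x, g x = v) -> linear_lattice_hom g.
Proof.
move=> g_lin g_le g_surj; split=> // x y.
- apply/esym/vmeet_eqP => v; have [z <-] := g_surj v.
  by rewrite !g_le le_vmeet.
- apply/esym/vjoin_eqP => v; have [z <-] := g_surj v.
  by rewrite !g_le vjoin_le.
Qed.

Lemma linear_order_iso_uHA (V W : vectorLatticeType R) (u : V) (w : W)
    (g : W -> V) :
  linear g -> (forall x, (0 <= g x) = (0 <= x)) ->
  (forall v, exists x, g x = v) -> g w = u -> uHA_isomorphic u w.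
Proof.
move=> g_lin g_ge0 g_surj gwu.
have g_le x y : (g x <= g y) = (x <= y).
  have gB : g (y - x) = g y - g x.
    by rewrite addrC -scaleN1r g_lin scaleN1r addrC.
  by rewrite -(vsubr_ge0 (g x)) -gB g_ge0 vsubr_ge0.
have g_inj x y : g x = g y -> x = y.
  by move=> gxy; apply/le_anti; rewrite -!g_le gxy lexx.
have [f fK] := choice g_surj; have gK : cancel g f by move=> x; apply: g_inj.
exists f, g; split=> //; last first.
  by split=> //; exact: linear_order_iso_lattice_hom.
split; last by rewrite -gwu gK.
apply: linear_order_iso_lattice_hom.
- by move=> a x y; apply: g_inj; rewrite g_lin !fK.
- by move=> x y; rewrite -g_le !fK.
- by move=> x; exists (g x).
Qed.

End OrderIsomorphisms.

(** * Functions on a finite discrete space *)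

Section FiniteDiscrete.
Variables (R : realType) (X : topologicalType) (N : nat) (p : 'I_N -> X).
Hypothesis p_bij : bijective p.
(** Discreteness of [X], in the form that turns every real function into an element of [LC]. *)
Hypothesis X_disc : forall f : X -> R, locally_constant f.

Local Notation LCX := (LC R X).

Definition LC_of (f : X -> R) : LCX := MkLC (asboolT (X_disc f)).

Lemma LC_eq (f g : LCX) : (forall x, f x = g x) -> f = g.
Proof. by move=> fg; apply/val_inj/funext. Qed.

Lemma LC_meetE (f g : LCX) x : (vmeet f g : LCX) x = Num.min (f x) (g x).
Proof. by []. Qed.

Lemma LC_scaleE a (f : LCX) x : (a *: f : LCX) x = a * f x.
Proof. by []. Qed.

Lemma LC_sumE (I : finType) (F : I -> LCX) x :
  (\sum_i F i : LCX) x = \sum_i F i x.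
Proof.
by apply: (big_ind2 (fun (f : LCX) s => f x = s)) => // f _ g _ <- <-.
Qed.

Lemma LC_has_dimension : has_dimension LCX N.
Proof.
have [q pK qK] := p_bij; have p_inj := can_inj pK.
(* The indicators of the points; evaluation at [p k] reads off coefficient [k]. *)
exists (fun i => LC_of (fun x => (x == p i)%:R)).
have sumE (c : 'I_N -> R) k :
    (\sum_i c i *: LC_of (fun x => (x == p i)%:R) : LCX) (p k) = c k.
  rewrite LC_sumE (bigD1 k)// big1 => [|i ik]; rewrite LC_scaleE/=.
    by rewrite eqxx mulr1 addr0.
  by rewrite (inj_eq p_inj) eq_sym (negbTE ik) mulr0.
split=> [c c0 i|f]; first by rewrite -sumE c0.
exists (fun i => f (p i)); apply: LC_eq => x.
by rewrite -(qK x) sumE.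
Qed.

(* A homomorphic image of a vector of finite support cannot be infinitely
   small, as [n *: f /\ g] is eventually constant in [n]. *)
Lemma LC_hyperarchimedean : hyperarchimedean LCX.
Proof.
have [q pK qK] := p_bij; move=> W h [h_lin h_meet h_join] h_surj v w v0 vw.
apply: contrapT => /forallNP nv.
have {}nv n : v *+ n.+1 <= w.
  by apply: contrapT => nvw; apply: (nv n.+1).
have h0 : h 0 = 0.
  by have := h_lin (-1) 0 0; rewrite scaleN1r oppr0 addr0 scaleN1r addNr.
have lift_pos t : 0 <= t -> exists2 f, 0 <= f & h f = t.
  move=> t0; have [f ft] := h_surj t; exists (vjoin f 0).
    exact: vjoin_ger.
  rewrite h_join ft h0; apply: vjoin_eqP => s.
  by apply/idP/andP => [ts|[]//]; split=> //; exact: le_trans ts.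
have [f /LC_leP f0 hf] := lift_pos _ (ltW v0).
have [g /LC_leP g0 hg] := lift_pos _ (le_trans (ltW v0) vw).
(* A sum of natural bounds dominates the quotient of [g] by [f] at every point; points where [f]
   vanishes are treated apart. The successor fits [meetE]. *)
pose n := (\sum_i Num.bound (g (p i) / f (p i))).+1.
have stable : vmeet (n%:R *: f) g = vmeet (n.+1%:R *: f) g.
  apply: LC_eq => x; rewrite !LC_meetE !LC_scaleE.
  have [fx0|fx0] := eqVneq (f x) 0; first by rewrite fx0 !mulr0.
  have fx : 0 < f x by rewrite lt_def fx0 f0.
  have gn : g x <= n%:R * f x.
    rewrite -ler_pdivrMr// ltW//.
    have gf0 : 0 <= g x / f x by apply: divr_ge0; [exact: g0|exact: ltW].
    apply: lt_le_trans (archi_boundP gf0) _.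
    by rewrite ler_nat /n -(qK x) (bigD1 (q x))//= -addSn leqW// leq_addr.
  rewrite !min_r//; apply: le_trans gn _.
  by rewrite ler_pM2r// ler_nat.
have hZ k : h (k%:R *: f) = v *+ k.
  by rewrite -[_ *: f]addr0 h_lin h0 addr0 hf scaler_nat.
(* As [v *+ k.+1 <= w], the meet with [w] changes nothing, so [stable] forces [v *+ n = v *+ n.+1],
   that is [v = 0]. *)
have meetE k : h (vmeet (k.+1%:R *: f) g) = v *+ k.+1.
  rewrite h_meet hZ hg; apply: vmeet_eqP => t.
  by apply/idP/andP => [tv|[]//]; split=> //; exact: le_trans (nv k).
have : v *+ n = v *+ n.+1 by rewrite -!meetE stable.
rewrite [RHS]mulrSr -[LHS]addr0 => /addrI v00.
by rewrite -v00 ltxx in v0.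
Qed.

Lemma LC_one_weak_unit : weak_unit (LC_one R X).
Proof.
split; first by apply/LC_leP => x; exact: ler01.
move=> f f0; apply: LC_eq => x.
have : Num.min 1 (f x) = 0 by rewrite -[RHS]/((0 : LCX) x) -f0.
rewrite minEle; case: ifP => // _ /eqP.
by rewrite oner_eq0.
Qed.

Lemma LC_unique (V : vectorLatticeType R) (u : V) :
  archimedean V -> weak_unit u -> has_dimension V N ->
  uHA_isomorphic u (LC_one R X).
Proof.
move=> archV uw dimV; have [q pK qK] := p_bij.
have [e [ed e_span ue]] := unit_coordinates archV uw dimV.
(* The indicator of [p i] goes to [e i], so the pointwise order becomes the coordinatewise one and
   the constant [1] goes to [u]. *)
apply: (@linear_order_iso_uHA _ _ _ _ _ (fun f : LCX => \sum_i f (p i) *: e i)).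
- move=> a f g /=; rewrite scaler_sumr -big_split/=; apply: eq_bigr => i _.
  by rewrite scalerA -scalerDl.
- move=> f; apply/idP/LC_leP => [f0 x|f0].
    by rewrite -(qK x); exact: (disjoint_family_coord_ge0 ed f0).
  by apply: vsumr_ge0 => i _; rewrite vlat_scale_ge0 ?f0// ltW//; case: ed.
- move=> v; have [c ->] := e_span v; exists (LC_of (c \o q)).
  by apply: eq_bigr => i _ /=; rewrite pK.
- by rewrite ue; apply: eq_bigr => i _; rewrite scale1r.
Qed.

End FiniteDiscrete.

(** * The cube on finitely many coordinates *)

Lemma cube_finite_locally_constant (R : realType) (T : Type) n (k : 'I_n -> T)
    (f : cube T -> R) :
  (forall t, exists i, k i = t) -> locally_constant f.
Proof.
move=> k_surj x.
have coord_open t : open [set y : cube T | y t = x t].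
  have proj_cts : continuous (fun y : cube T => (y t : bool)).
    exact: (@proj_continuous {classic T} (fun=> bool) t).
  exact: (iffLR (continuousP _) proj_cts [set x t] (discrete_open _)).
(* A finite intersection of open cylinders, one per coordinate, isolates [x]. *)
pose U := \big[setI/setT]_(i < n) [set y : cube T | y (k i) = x (k i)].
have Ux y : U y -> y = x.
  move=> Uy; apply/funext => t; have [i <-] := k_surj t.
  by move: Uy; rewrite /U (bigD1 i)//= => -[].
exists U; split; last by move=> y z /Ux -> /Ux ->.
split; last by apply: (big_ind (fun A : set (cube T) => A x)).
by apply: (big_ind open) => //; [exact: openT|exact: openI].
Qed.

Lemma card_II_enumeration (T : Type) n : [set: T] #= `I_n ->
  exists k : 'I_n -> T, bijective k.
Proof.
move=> /card_set_bijP[h [h_fun h_inj h_surj]].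
have hn t : (h t < n)%N by exact: h_fun.
have /choice[k hk] : forall i : 'I_n, exists t, h t = i.
  by move=> i; have [t _ ht] := h_surj i (ltn_ord i); exists t.
exists k, (fun t => Ordinal (hn t)) => [i|t].
  by apply: val_inj; rewrite /= hk.
by apply: h_inj; rewrite ?inE// hk.
Qed.

(** Points of the cube correspond through [k] to boolean functions on ['I_n], a finite type with
    [2 ^ n] elements. *)
Lemma cube_enumeration (T : Type) n (k : 'I_n -> T) : bijective k ->
  exists p : 'I_(2 ^ n) -> cube T, bijective p.
Proof.
move=> [k' kK k'K].
have cardE : (2 ^ n)%N = #|{ffun 'I_n -> bool}|.
  by rewrite card_ffun card_bool card_ord.
pose p (i : 'I_(2 ^ n)) : cube T := fun t => enum_val (cast_ord cardE i) (k' t).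
pose q (x : cube T) := cast_ord (esym cardE) (enum_rank [ffun i => x (k i)]).
exists p, q => [i|x].
  rewrite /q /p; apply: (can_inj (cast_ordK cardE)).
  rewrite cast_ordKV; apply: enum_val_inj; rewrite enum_rankK.
  by apply/ffunP => j; rewrite ffunE kK.
by apply/funext => t; rewrite /p /q cast_ordKV enum_rankK ffunE k'K.
Qed.

(* The dimension is 2 ^ n, not n: the space {0,1}^n is discrete with 2 ^ n
   points, so LC({0,1}^n) consists of all real functions on these points. *)
Theorem corollary6p4 (R : realType) (n : nat) (T : Type)
    (hS : [set: T] #= `I_n) :
  [/\ uHA_object (LC_free_unit R T),
      has_dimension (LC_free R T) (2 ^ n)%N
    & forall (V : vectorLatticeType R) (u : V),
        uHA_object u -> has_dimension V (2 ^ n)%N ->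
        uHA_isomorphic u (LC_free_unit R T)].
Proof.
have [k k_bij] := card_II_enumeration hS.
have [p p_bij] := cube_enumeration k_bij.
have cube_disc (f : cube T -> R) : locally_constant f.
  apply: (cube_finite_locally_constant (k := k)) => t.
  by have [k' _ k'K] := k_bij; exists (k' t).
split.
- split; first exact: LC_hyperarchimedean p_bij.
  exact: LC_one_weak_unit.
- exact: LC_has_dimension p_bij cube_disc.
- move=> V u [hypV uw]; apply: (LC_unique p_bij cube_disc) => //.
  (* [V] is its own homomorphic image under the identity, hence Archimedean. *)
  apply: (hypV V id); last by move=> v; exists v.
  by split.
Qed.
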